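(* $M(x,z)\,S\,{}^t\!M(x,z)\,S=(1-z\,\ell(x))^2E$, where ${}^t$ denotes transposition and $E$ is the $2n\times2n$ identity matrix.
   Context: Let $n\ge 4$. $x=(x_1,\dots,x_n,\bar x_{n-1},\dots,\bar x_1)$ are real variables; identities are between rational functions (hold wherever both sides are defined). Level $\ell(x)=x_1\cdots x_n\bar x_{n-1}\cdots\bar x_1$; $\delta_{ij}$ Kronecker delta; empty products are $1$. $T=(\delta_{i+j,n+1}(-1)^{i-1})_{1\le i,j\le n}$ and $S=\begin{pmatrix}0&T\\{}^tT&0\end{pmatrix}$, a $2n\times2n$ matrix. **The $2n\times 2n$ matrix $M(x,z)$.** Write $M_{i,j}=M(x,z)_{i,j}$, $\ell=\ell(x)$, $\bar X_i=1+\bar x_i/x_i$. First column: $M_{1,1}=x_1/\bar x_1$; $M_{i,1}=x_1\cdots x_{i-1}(1+x_i/\bar x_i)$ for $2\le i\le n-1$; $M_{n,1}=x_1\cdots x_n$; $M_{n+1,1}=x_1\cdots x_{n-1}$; $M_{i,1}=\ell/(\bar x_1\cdots\bar x_{2n-i})$ for $n+2\le i\le 2n$. Other columns ($1\le i\le 2n$): $M_{i,j+1}=\frac{M_{i,j}}{x_j}+(\ell z-1)\big(\frac{\delta_{i,j}}{\bar x_j}+\delta_{i,j+1}\big)$ for $1\le j\le n-2$; $M_{i,n}=\frac{M_{i,n-1}}{x_{n-1}}+(\ell z-1)\big(\frac{\delta_{i,n-1}}{\bar x_{n-1}}+\delta_{i,n+1}\big)$; $M_{i,n+1}=\frac{M_{i,n-1}}{x_{n-1}x_n}+(\ell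 z-1)\big(\frac{\delta_{i,n-1}}{\bar x_{n-1}x_n}+\delta_{i,n}\big)$; $M_{i,2n}=z\frac{\bar x_1}{x_1}M_{i,1}+\delta_{i,2n}\frac{\bar x_1}{x_1}(1-\ell z)+\delta_{i,1}z(\ell z-1)$; $M_{i,2n-1}=z\bar x_1\bar X_2M_{i,1}+(1-\ell z)\big(\delta_{i,2n}\bar x_1\bar X_2+\delta_{i,2n-1}\frac{\bar x_2}{x_2}\big)$; $M_{i,2n-j}=\bar x_j\frac{\bar X_{j+1}}{\bar X_j}M_{i,2n+1-j}+(1-\ell z)\big(\delta_{i,2n+1-j}\bar x_j\frac{\bar X_{j+1}}{\bar X_j}+\delta_{i,2n-j}\frac{\bar x_{j+1}}{x_{j+1}}\big)$ for $2\le j\le n-2$. *)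

(* Defs.v *)
(* Mathematical Components *)
From mathcomp Require Import all_boot all_algebra.

Set Implicit Arguments.
Unset Strict Implicit.
Unset Printing Implicit Defensive.

Import GRing.Theory.
Local Open Scope ring_scope.

(* The point x is the single (2n-1)-tuple
     (x_1, ..., x_n, xbar_(n-1), ..., xbar_1).
   All natural-number indices below are 1-based, up to [mxM] and [mxT], which
   shift the 0-based ordinals by one. *)
Section Entries.

Variables (K : fieldType) (n : nat) (x : (n.*2.-1).-tuple K) (z : K).

(* x_i for 1 <= i <= n *)
Definition xvar (i : nat) : K := x`_i.-1.

(* xbar_i for 1 <= i <= n - 1 : the last coordinate is xbar_1 *)
Definition xbar (i : nat) : K := x`_(n.*2.-1 - i).

Definition level : K :=
  (\prod_(1 <= i < n.+1) xvar i) * (\prod_(1 <= i < n) xbar i).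

Definition Xbar (i : nat) : K := 1 + xbar i / xvar i.

Definition kron (i j : nat) : K := (i == j)%:R.

Definition col1 (i : nat) : K :=
  if i == 1%N then xvar 1 / xbar 1
  else if (i < n)%N then
    (\prod_(1 <= k < i) xvar k) * (1 + xvar i / xbar i)
  else if i == n then \prod_(1 <= k < n.+1) xvar k
  else if i == n.+1 then \prod_(1 <= k < n) xvar k
  else level / \prod_(1 <= k < (n.*2 - i).+1) xbar k.

(* [left_col k i] is M_(i, k+1), for k + 1 <= n - 1 *)
Fixpoint left_col (k i : nat) : K :=
  if k is j.+1 then
    let J := j.+1 in
    left_col j i / xvar J
      + (level * z - 1) * (kron i J / xbar J + kron i J.+1)
  else col1 i.

Definition col_n (i : nat) : K :=
  left_col (n - 2) i / xvar n.-1
    + (level * z - 1) * (kron i n.-1 / xbar n.-1 + kron i n.+1).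

Definition col_n1 (i : nat) : K :=
  left_col (n - 2) i / (xvar n.-1 * xvar n)
    + (level * z - 1) * (kron i n.-1 / (xbar n.-1 * xvar n) + kron i n).

Definition col_2n (i : nat) : K :=
  z * (xbar 1 / xvar 1) * col1 i
    + kron i n.*2 * (xbar 1 / xvar 1) * (1 - level * z)
    + kron i 1 * z * (level * z - 1).

Definition col_2n1 (i : nat) : K :=
  z * xbar 1 * Xbar 2 * col1 i
    + (1 - level * z) * (kron i n.*2 * xbar 1 * Xbar 2
                         + kron i n.*2.-1 * (xbar 2 / xvar 2)).

(* [right_col k i] is M_(i, 2n-1-k), for 2n - 1 - k >= n + 2; in the recursive
   case J = k + 1 >= 2, so that column 2n - J is obtained from 2n + 1 - J. *)
Fixpoint right_col (k i : nat) : K :=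
  if k is j.+1 then
    let J := j.+2 in
    let c := xbar J * (Xbar J.+1 / Xbar J) in
    c * right_col j i
      + (1 - level * z) * (kron i (n.*2.+1 - J) * c
                           + kron i (n.*2 - J) * (xbar J.+1 / xvar J.+1))
  else col_2n1 i.

Definition entryM (i j : nat) : K :=
  if (j < n)%N then left_col j.-1 i
  else if j == n then col_n i
  else if j == n.+1 then col_n1 i
  else if j == n.*2 then col_2n i
  else right_col (n.*2.-1 - j) i.

(* The size n + n is 2n, written so as to match [block_mx] in [mxS]. *)
Definition mxM : 'M[K]_(n + n) :=
  \matrix_(i < n + n, j < n + n) entryM i.+1 j.+1.

End Entries.

Definition mxT (K : fieldType) (n : nat) : 'M[K]_n :=
  \matrix_(i < n, j < n) ((i.+1 + j.+1 == n.+1)%N%:R * (-1) ^+ i).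

Definition mxS (K : fieldType) (n : nat) : 'M[K]_(n + n) :=
  block_mx 0 (mxT K n) (mxT K n)^T 0.

(* Every denominator in the formulas for the entries of M is nonzero.  Division
   by zero is total in a field here, so this must be required explicitly; over
   a field of rational functions in the coordinates of x it holds for the
   generic point. *)
Definition M_defined (K : fieldType) (n : nat) (x : (n.*2.-1).-tuple K) : Prop :=
  [/\ forall i, (1 <= i <= n)%N -> xvar x i != 0,
      forall i, (1 <= i <= n - 1)%N -> xbar x i != 0
    & forall j, (2 <= j <= n - 2)%N -> Xbar x j != 0].

(* Main.v *)
Require Import Defs.
From mathcomp Require Import all_boot all_algebra.
From mathcomp Require Import zify ring.
Set Implicit Arguments.
Unset Strict Implicit.
Unset Printing Implicit Defensive.
Import GRing.Theory.
Local Open Scope ring_scope.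

(** Write [t = z l - 1] and [y = z l = 1 + t], where [l] is the level, and let
    [w] be the first column of [M].  At [t = 0] the matrix [M] degenerates to a
    rank one matrix [w_i v_j], and in general its recursively defined columns
    have the closed form ([entryM_factor])

      [M_(i,j) = w_i v_j phi_(i,j) + t tau_i delta_(i,j)],

    where [phi_(i,j)] is [y] if [i < j] and [1] otherwise, with two exceptions
    ([order_weight]), and [tau_i] is [0] for [i] in [{1, n, n+1, 2n}] and [1]
    otherwise ([regular]).

    Write [j'] for [2n + 1 - j].  Since [S] is an antidiagonal matrix of signs
    [s_j = s_(j')] with square [1], the claim says that the rows of [M] satisfy
    [sum_j s_j M_(i,j) M_(k,j') = t ^ 2 s_i] if [k = i'], and [0] otherwise
    ([row_pairing]).  The point is that there is a sequence [H] on [0, ..., 2n],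
    antisymmetric under [m -> 2n - m] ([flux]), namely
    [H_m = (-1) ^ (m-1) (xbar_1 ... xbar_m) / (x_1 ... x_m)] for [0 < m < n],
    [H_0 = H_n = 0], such that

      [l s_j v_j v_(j') = H_j - H_(j-1)]    ([flux_increment]),
      [l s_j v_(j') = H_j w_j]  if [tau_j = 1]    ([flux_regular]).

    Multiplying the pairing of rows [i] and [k] by [l] and expanding therefore
    gives [w_i w_k] times

      [sum_j (H_j - H_(j-1)) phi_(i,j) phi_(k,j')
        + t tau_i H_i phi_(k,i') + t tau_k H_k phi_(i,k')]

    plus [l t ^ 2 s_i tau_i delta_(k,i')].  As [phi] only depends on the order
    of its arguments up to the exceptions, the sum telescopes to
    [- t phi_(i,k') (H_i + H_k)] plus corrections ([sum_order_weights]), and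
    altogether the displayed bracket collapses to
    [t ^ 2 (1 - tau_i) delta_(k,i') (H_i - H_(i-1))] ([order_weight_pairing]).
    So everything vanishes unless [k = i'], and there the value is
    [l t ^ 2 s_i]: at once when [tau_i = 1], and because
    [w_i v_i w_(i') v_(i') = 1] when [tau_i = 0] ([diag_irregular]).  Arguing
    with rows instead of inverting [M] covers the degenerate case [t = 0]. *)

(** * Telescoping sums with order weights *)

Section Sums.
Variable K : comPzRingType.

Lemma sum_kronecker (N : nat) (F : nat -> K) (c : nat) : (c < N)%N ->
  \sum_(0 <= j < N) F j * (j == c)%:R = F c.
Proof.
move=> hc; rewrite (bigD1_seq c) ?mem_index_iota ?iota_uniq //=.
by rewrite eqxx mulr1 big1 ?addr0 // => j /negPf ->; rewrite mulr0.
Qed.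

Lemma telescope_window (N : nat) (H : nat -> K) (a b : nat) : (b <= N)%N ->
  \sum_(0 <= j < N) (H j.+1 - H j) * (a <= j < b)%N%:R
    = (a <= b)%N%:R * (H b - H a).
Proof.
move=> leN; have [le_ab | lt_ba] := leqP a b; last first.
  rewrite mul0r big1 // => j _; case: andP => [[h1 h2]|]; last by rewrite mulr0.
  lia.
rewrite mul1r -(telescope_sumr H) //.
rewrite (big_nat_widen _ _ _ _ _ leN) (big_nat_widenl _ _ _ _ _ (leq0n a)).
rewrite [RHS]big_mkcond; apply: eq_big_nat => j _ /=.
by rewrite andbC; case: ifP => _; rewrite ?mulr1 ?mulr0.
Qed.

(** Each weight splits into [1] and [t] times the indicator of a half-line
    ([k < N - j] meaning [j < N - k]), so the sum is a combination of four
    telescoping window sums; [H N = 0] and [H (N - k) = - H k] make every one of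
    them a multiple of [H i + H k]. *)
Lemma sum_order_weights (N : nat) (H : nat -> K) (t : K) (i k : nat) :
    (forall m, (m <= N)%N -> H (N - m)%N = - H m) -> H 0%N = 0 ->
    (0 < i <= N)%N -> (0 < k <= N)%N ->
  \sum_(0 <= j < N) (H j.+1 - H j)
     * (1 + t * (i < j.+1)%N%:R) * (1 + t * (k < N - j)%N%:R)
  = - t * (1 + t * (i + k <= N)%N%:R) * (H i + H k).
Proof.
move=> Hanti H0 hi hk.
have HN : H N = 0 by rewrite -[N in H N]subn0 Hanti // H0 oppr0.
pose win a b := \sum_(0 <= j < N) (H j.+1 - H j) * (a <= j < b)%N%:R.
transitivity (win 0%N N + t * win i N + t * win 0%N (N - k)%N
              + t ^+ 2 * win i (N - k)%N).
  rewrite /win !mulr_sumr -!big_split /=; apply: eq_big_nat => j hj.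
  have -> : (j < N)%N by lia.
  have -> : (j < N - k)%N = (k < N - j)%N by lia.
  rewrite andbT -[(i <= j)%N]/(i < j.+1)%N.
  by case: (i < j.+1)%N; case: (k < N - j)%N => /=; ring.
rewrite /win !telescope_window ?leq_subr // Hanti; last by lia.
have -> : (i <= N)%N by lia.
have -> : (i <= N - k)%N = (i + k <= N)%N by lia.
by rewrite /= HN H0; ring.
Qed.
End Sums.

(** * The weights of the matrix and their pairing *)

Section Kernel.
Variables (K : comPzRingType) (n : nat) (t : K).
Hypothesis hn : (4 <= n)%N.

(** With [y = 1 + t] the generic values are [y] above the diagonal and [1]
    elsewhere.  The corner entry [(1, 2n)] is [y ^ 2], and the entry [(n+1, n)]
    is [y] because [n] and [n + 1] play symmetric roles. *)
Definition order_weight (i j : nat) : K :=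
  1 + t * (i < j)%N%:R + t * (t + 1) * ((i == 1%N) && (j == n.*2))%:R
    + t * ((i == n.+1) && (j == n))%:R.

(** The columns whose diagonal entry carries the extra summand [t]. *)
Definition regular (i : nat) : bool :=
  [&& i != 1%N, i != n, i != n.+1 & i != n.*2].

(** The generic weights contribute [- t phi_(i,k') (H i + H k)], which cancels
    the two last terms on the left when [i] and [k] are regular.  When [i] is
    not regular the term in [H i] is missing from the left; its place is taken
    by the contribution of the exceptional weights of row [i], since
    [H (2n) - H (2n - 1) = H 1], [H n - H (n - 1) = H (n + 1)] and
    [H n = H (2n) = 0].  The same holds for [k], and only a residue at
    [i + k = 2n + 1] is left over. *)
Lemma order_weight_pairing (H : nat -> K) (i k : nat) :
    (forall m, (m <= n.*2)%N -> H (n.*2 - m)%N = - H m) ->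
    H 0%N = 0 -> H n = 0 ->
    (0 < i <= n.*2)%N -> (0 < k <= n.*2)%N ->
  \sum_(0 <= j < n.*2)
      (H j.+1 - H j) * order_weight i j.+1 * order_weight k (n.*2 - j)%N
    + t * (regular i)%:R * H i * order_weight k (n.*2.+1 - i)%N
    + t * (regular k)%:R * H k * order_weight i (n.*2.+1 - k)%N
  = t ^+ 2 * (~~ regular i && (i + k == n.*2.+1)%N)%:R * (H i - H i.-1).
Proof.
move=> Hanti H0 Hn hi hk.
set N := n.*2 in Hanti hi hk *.
have HN : H N = 0 by rewrite -[N in H N]subn0 Hanti // H0 oppr0.
have HN1 : H N.-1 = - H 1%N by rewrite -Hanti ?subn1 //; rewrite /N; lia.
have Hn1 : H n.-1 = - H n.+1.
  by rewrite -Hanti; [congr H; rewrite /N; lia | rewrite /N; lia].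
pose o a b : K := 1 + t * (a < b)%N%:R.
(* Two exceptional weights never meet in one summand, so the product expands
   into the generic sum and four sums over a single index. *)
have -> : \sum_(0 <= j < N) (H j.+1 - H j) * order_weight i j.+1 * order_weight k (N - j)%N
  = \sum_(0 <= j < N) (H j.+1 - H j) * o i j.+1 * o k (N - j)%N
    + \sum_(0 <= j < N) (H j.+1 - H j) * o k (N - j)%N
         * (t * (t + 1) * (i == 1%N)%:R) * (j == N.-1)%:R
    + \sum_(0 <= j < N) (H j.+1 - H j) * o k (N - j)%N
         * (t * (i == n.+1)%:R) * (j == n.-1)%:R
    + \sum_(0 <= j < N) (H j.+1 - H j) * o i j.+1
         * (t * (t + 1) * (k == 1%N)%:R) * (j == 0%N)%:R
    + \sum_(0 <= j < N) (H j.+1 - H j) * o i j.+1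
         * (t * (k == n.+1)%:R) * (j == n)%:R.
  rewrite -!big_split /=; apply: eq_big_nat => j hj; rewrite /order_weight /o -/N.
  have -> : (j.+1 == N) = (j == N.-1) by lia.
  have -> : (j.+1 == n) = (j == n.-1) by lia.
  have -> : (N - j == N)%N = (j == 0%N) by lia.
  have -> : (N - j == n)%N = (j == n) by lia.
  rewrite -!mulnb !natrM.
  case: (j =P N.-1) => e1; case: (j =P n.-1) => e2; case: (j =P 0%N) => e3;
    case: (j =P n) => e4; rewrite /= ?(mulr0, mulr1, addr0); try ring;
    try (exfalso; move: e1; rewrite /N; lia).
rewrite sum_order_weights // !sum_kronecker; try by rewrite /N; lia.
have -> : N.-1.+1 = N by rewrite /N; lia.
have -> : n.-1.+1 = n by lia.
rewrite HN HN1 Hn Hn1 H0.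
have -> : (N - N.-1 = 1)%N by rewrite /N; lia.
have -> : (N - n.-1 = n.+1)%N by rewrite /N; lia.
(* The exceptional weights of row i0 replace its missing regular term, up to
   a residue at i0 + k0 = N + 1. *)
have correction i0 k0 : (0 < i0 <= N)%N -> (0 < k0 <= N)%N ->
    t * (t + 1) * (i0 == 1%N)%:R * H 1%N * o k0 1%N
      + t * (i0 == n.+1)%:R * H n.+1 * o k0 n.+1
    = t * (~~ regular i0)%:R * H i0 * o k0 (N.+1 - i0)%N
      + t ^+ 2 * ((i0 == 1%N) && (k0 == N))%:R * H 1%N
      + t ^+ 2 * ((i0 == n.+1) && (k0 == n))%:R * H n.+1.
  move=> hi0 hk0; rewrite /regular -/N /o.
  have -> : (k0 < 1)%N = false by lia.
  have [->|i1] := eqVneq i0 1%N.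
    have -> : (1 == n.+1)%N = false by lia.
    have -> : (k0 < N.+1 - 1)%N = (k0 != N) by lia.
    by case: (k0 == N) => /=; ring.
  have [->|i2] := eqVneq i0 n.+1.
    have -> : (n.+1 == n)%N = false by lia.
    have -> : (k0 < N.+1 - n.+1)%N = (k0 < n)%N by rewrite /N; lia.
    rewrite ltnS leq_eqVlt.
    by have [->|kn] := eqVneq k0 n; rewrite ?ltnn /=; ring.
  have [->|i3] := eqVneq i0 n; first by rewrite Hn /=; ring.
  have [->|i4] := eqVneq i0 N; first by rewrite HN /=; ring.
  by rewrite /=; ring.
have weight_regular i0 k0 : (0 < i0 <= N)%N ->
    (regular i0)%:R * order_weight k0 (N.+1 - i0)%N = (regular i0)%:R * o k0 (N.+1 - i0)%N.
  move=> hi0; have [/and4P[/eqP i1 /eqP i2 /eqP i3 /eqP i4]|_] := boolP (regular i0);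
    last by rewrite !mul0r.
  have e1 : ((N.+1 - i0)%N == N) = false by lia.
  have e2 : ((N.+1 - i0)%N == n) = false by move: i3; rewrite /N; lia.
  by rewrite /order_weight /o -/N e1 e2 !andbF /=; ring.
have special : (~~ regular i && (i + k == N.+1)%N)%:R * (H i - H i.-1)
    = ((i == 1%N) && (k == N))%:R * H 1%N + ((k == 1%N) && (i == N))%:R * H 1%N
      + ((i == n.+1) && (k == n))%:R * H n.+1
      + ((k == n.+1) && (i == n))%:R * H n.+1.
  rewrite /regular -/N.
  have e1 : (1 == n.+1)%N = false by lia.
  have e2 : (1 == n)%N = false by lia.
  have e3 : (1 == N)%N = false by rewrite /N; lia.
  have e4 : (n == N)%N = false by rewrite /N; lia.
  have e5 : (n.+1 == N)%N = false by rewrite /N; lia.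
  have e6 : (n.+1 == n)%N = false by lia.
  have [->|i1] := eqVneq i 1%N.
    have -> : (1 + k == N.+1)%N = (k == N) by lia.
    by rewrite e1 e2 e3 H0 !andbF /=; ring.
  have [->|i2] := eqVneq i n.
    have -> : (n + k == N.+1)%N = (k == n.+1) by rewrite /N; lia.
    by rewrite e4 [n == n.+1]eq_sym e6 Hn Hn1 !(andbF, andbT) /=; ring.
  have [->|i3] := eqVneq i n.+1.
    have -> : (n.+1 + k == N.+1)%N = (k == n) by rewrite /N; lia.
    by rewrite e5 !(andbF, andbT) /= Hn; ring.
  have [->|i4] := eqVneq i N.
    have -> : (N + k == N.+1)%N = (k == 1%N) by lia.
    by rewrite HN HN1 !(andbF, andbT) /=; ring.
  by rewrite !andbF /=; ring.
have comp i0 : (~~ regular i0)%:R = 1 - (regular i0)%:R :> K.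
  by case: (regular i0); rewrite /= ?subrr ?subr0.
have swap : o k (N.+1 - i)%N = o i (N.+1 - k)%N by rewrite /o; do 3!f_equal; lia.
have comm : (1 + t * (i + k <= N)%N%:R) = o i (N.+1 - k)%N.
  by rewrite /o; do 3!f_equal; lia.
have reorder r h p : t * r * h * p = t * h * (r * p) by ring.
rewrite -[RHS]mulrA special !reorder !weight_regular // swap comm.
have := correction k i hk hi; have := correction i k hi hk.
rewrite swap !comp => sik ski.
transitivity (- t * o i (N.+1 - k)%N * (H i + H k)
  + (t * (t + 1) * (i == 1%N)%:R * H 1%N * o k 1%N
      + t * (i == n.+1)%:R * H n.+1 * o k n.+1)
  + (t * (t + 1) * (k == 1%N)%:R * H 1%N * o i 1%N
      + t * (k == n.+1)%:R * H n.+1 * o i n.+1)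
  + t * H i * ((regular i)%:R * o i (N.+1 - k)%N)
  + t * H k * ((regular k)%:R * o i (N.+1 - k)%N)); first by ring.
by rewrite sik ski; ring.
Qed.
End Kernel.

(** * The antidiagonal form *)

Section AntidiagonalForm.
Variables (K : fieldType) (n : nat).

(** The index is 1-based.  The minimum makes the sign [(-1) ^ (j - 1)] on the
    first half and invariant under [j -> 2n + 1 - j]. *)
Definition antidiag_sign (j : nat) : K := (-1) ^+ (minn j (n.*2.+1 - j)).-1.
Local Notation s := antidiag_sign.

Lemma sign_sym j : (0 < j <= n.*2)%N -> s (n.*2.+1 - j) = s j.
Proof. by move=> hj; rewrite /s subKn 1?minnC //; lia. Qed.

Lemma sign_left j : (j <= n)%N -> s j = (-1) ^+ j.-1.
Proof. by move=> hj; rewrite /s; congr (_ ^+ _.-1); lia. Qed.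

Lemma mirror_ind (P : nat -> Prop) :
  (forall j, (0 < j <= n)%N -> P j) ->
  (forall j, (0 < j <= n)%N -> P j -> P (n.*2.+1 - j)%N) ->
  forall j, (0 < j <= n.*2)%N -> P j.
Proof.
move=> Pl Pm j hj; have [jn|jn] := leqP j n; first by apply: Pl; lia.
have -> : j = (n.*2.+1 - (n.*2.+1 - j))%N by lia.
by apply: Pm; [lia | apply: Pl; lia].
Qed.

Lemma mxSE (i j : 'I_(n + n)) : mxS K n i j = s i.+1 * (j == rev_ord i)%:R.
Proof.
have -> : (j == rev_ord i) = (i + j == (n + n).-1)%N.
  by rewrite -val_eqE /=; have := ltn_ord i; have := ltn_ord j; lia.
rewrite /mxS /s mxE; case: splitP => i' ei; rewrite mxE; case: splitP => j' ej;
  rewrite !mxE ei ej; have hi := ltn_ord i'; have hj := ltn_ord j'.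
- have -> : (i' + j' == (n + n).-1)%N = false by lia.
  by rewrite mulr0.
- have -> : (minn i'.+1 (n.*2.+1 - i'.+1)).-1 = i' by lia.
  by rewrite mulrC; congr (_ * _%:R); lia.
- have -> : (minn (n + i').+1 (n.*2.+1 - (n + i').+1)).-1 = (n.-1 - i')%N by lia.
  have -> : (j'.+1 + i'.+1 == n.+1)%N = (n + i' + j' == (n + n).-1)%N by lia.
  have [e|_] := eqVneq; last by rewrite mulr0 mul0r.
  by rewrite mul1r mulr1; congr (_ ^+ _); lia.
- have -> : (n + i' + (n + j') == (n + n).-1)%N = false by lia.
  by rewrite mulr0.
Qed.

Lemma mulmxSE (A : 'M[K]_(n + n)) i j :
  (A *m mxS K n) i j = s j.+1 * A i (rev_ord j).
Proof.
rewrite mxE (bigD1 (rev_ord j)) //= mxSE rev_ordK eqxx mulr1 big1 ?addr0.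
  rewrite mulrC -(@sign_sym j.+1); last by have := ltn_ord j; lia.
  by congr (s _ * _); rewrite /=; have := ltn_ord j; lia.
move=> k hk; rewrite mxSE; have [e|_] := eqVneq; last by rewrite !mulr0.
by move: hk; rewrite e rev_ordK eqxx.
Qed.

Lemma antidiag_sign_sqr j : s j * s j = 1.
Proof. by rewrite -expr2 /s sqrr_sign. Qed.
End AntidiagonalForm.

(** * Closed form of the entries *)

Section Factors.
Variables (K : fieldType) (n : nat) (x : (n.*2.-1).-tuple K) (z : K).
Hypotheses (hn : (4 <= n)%N) (hx : M_defined x).

Local Notation t := (level x * z - 1).
Local Notation w := (Defs.col1 x).
Local Notation s := (antidiag_sign K n).

(** Both products stop at index [m - 1], so that [xprod 1 = xbprod 1 = 1]. *)
Definition xprod (m : nat) : K := \prod_(1 <= k < m) xvar x k.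
Definition xbprod (m : nat) : K := \prod_(1 <= k < m) xbar x k.

(** The factor [v] of the rank one part [w_i v_j] of the matrix, where [w] is
    its first column. *)
Definition col_factor (j : nat) : K :=
  if (j <= n)%N then (xprod j)^-1
  else if j == n.+1 then (xprod n.+1)^-1
  else if j == n.*2 then xbar x 1 / (xvar x 1 * level x)
  else xbprod (n.*2 - j).+1 * Xbar x (n.*2 - j).+1 / level x.
Local Notation v := col_factor.

Lemma xvar_neq0 i : (0 < i <= n)%N -> xvar x i != 0.
Proof. by case: hx => h _ _; apply: h. Qed.

Lemma xbar_neq0 i : (0 < i < n)%N -> xbar x i != 0.
Proof. by case: hx => _ h _ hi; apply: h; lia. Qed.

Lemma Xbar_neq0 i : (1 < i < n.-1)%N -> Xbar x i != 0.
Proof. by case: hx => _ _ h hi; apply: h; lia. Qed.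

Lemma xprod1 : xprod 1 = 1. Proof. by rewrite /xprod big_nil. Qed.
Lemma xbprod1 : xbprod 1 = 1. Proof. by rewrite /xbprod big_nil. Qed.

Lemma xprodS m : (0 < m)%N -> xprod m.+1 = xprod m * xvar x m.
Proof. by move=> m0; rewrite /xprod big_nat_recr. Qed.

Lemma xbprodS m : (0 < m)%N -> xbprod m.+1 = xbprod m * xbar x m.
Proof. by move=> m0; rewrite /xbprod big_nat_recr. Qed.

Lemma xprod_neq0 m : (m <= n.+1)%N -> xprod m != 0.
Proof.
move=> hm; rewrite /xprod prodf_seq_neq0; apply/allP => i.
by rewrite mem_index_iota => hi; apply/implyP => _; apply: xvar_neq0; lia.
Qed.

Lemma xbprod_neq0 m : (m <= n)%N -> xbprod m != 0.
Proof.
move=> hm; rewrite /xbprod prodf_seq_neq0; apply/allP => i.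
by rewrite mem_index_iota => hi; apply/implyP => _; apply: xbar_neq0; lia.
Qed.

Lemma levelE : level x = xprod n * xvar x n * xbprod n.
Proof. by rewrite /level -/(xprod _) -/(xbprod _) xprodS //; lia. Qed.

Lemma level_neq0 : level x != 0.
Proof. by rewrite levelE !mulf_neq0 ?xprod_neq0 ?xbprod_neq0 ?xvar_neq0 //; lia. Qed.

Lemma col1_1 : w 1 = xvar x 1 / xbar x 1. Proof. by []. Qed.

Lemma col1_left i : (1 < i < n)%N -> w i = xprod i * (1 + xvar x i / xbar x i).
Proof.
move=> hi; rewrite /Defs.col1.
have -> : (i == 1%N) = false by lia.
by have -> : (i < n)%N by lia.
Qed.

Lemma col1_n : w n = xprod n * xvar x n.
Proof.
rewrite /Defs.col1 ltnn eqxx; have -> : (n == 1%N) = false by lia.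
by rewrite -/(xprod _) xprodS //; lia.
Qed.

Lemma col1_n1 : w n.+1 = xprod n.
Proof.
rewrite /Defs.col1 eqxx.
have -> : (n.+1 == 1%N) = false by lia.
have -> : (n.+1 < n)%N = false by lia.
by have -> : (n.+1 == n)%N = false by lia.
Qed.

Lemma col1_right j : (0 < j < n)%N -> w (n.*2.+1 - j) = level x / xbprod j.
Proof.
move=> hj; rewrite /Defs.col1.
have -> : (n.*2.+1 - j == 1)%N = false by lia.
have -> : (n.*2.+1 - j < n)%N = false by lia.
have -> : (n.*2.+1 - j == n)%N = false by lia.
have -> : (n.*2.+1 - j == n.+1)%N = false by lia.
by have -> : ((n.*2 - (n.*2.+1 - j)).+1 = j)%N by lia.
Qed.

Lemma col1_last : w n.*2 = level x.
Proof.
have -> : n.*2 = (n.*2.+1 - 1)%N by lia.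
by rewrite col1_right ?xbprod1 ?divr1 //; lia.
Qed.

Lemma col_factor_left j : (j <= n)%N -> v j = (xprod j)^-1.
Proof. by rewrite /v => ->. Qed.

Lemma col_factor_n1 : v n.+1 = (xprod n * xvar x n)^-1.
Proof. by rewrite /v ltnn eqxx xprodS //; lia. Qed.

Lemma col_factor_last : v n.*2 = xbar x 1 / (xvar x 1 * level x).
Proof.
rewrite /v; have -> : (n.*2 <= n)%N = false by lia.
have -> : (n.*2 == n.+1)%N = false by lia.
by rewrite eqxx.
Qed.

Lemma col_factor_right j : (1 < j < n)%N ->
  v (n.*2.+1 - j) = xbprod j * Xbar x j / level x.
Proof.
move=> hj; rewrite /v.
have -> : (n.*2.+1 - j <= n)%N = false by lia.
have -> : (n.*2.+1 - j == n.+1)%N = false by lia.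
have -> : (n.*2.+1 - j == n.*2)%N = false by lia.
by have -> : ((n.*2 - (n.*2.+1 - j)).+1 = j)%N by lia.
Qed.

(** These diagonal values are what makes the Kronecker terms of the recursion
    for the columns fit the closed form: [t / xbar_j] added to the diagonal
    summand [t / x_j] carried over from column [j > 1] is
    [t w_j v_j / x_j = t w_j v_(j+1)], that is the change of weight in row [j]
    when passing from column [j] to column [j + 1]. *)
Lemma diag_left j : (0 < j < n)%N ->
  w j * v j = (j != 1%N)%:R + xvar x j / xbar x j.
Proof.
move=> hj; rewrite col_factor_left; last by lia.
have xb := xbar_neq0 hj.
have [->|j1] := eqVneq j 1%N; first by rewrite col1_1 xprod1 /= add0r invr1 mulr1.
rewrite col1_left; last by lia.
have p : xprod j != 0 by apply: xprod_neq0; lia.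
by rewrite /=; field; rewrite xb p.
Qed.

Lemma diag_right j : (1 < j < n)%N ->
  w (n.*2.+1 - j) * v (n.*2.+1 - j) = Xbar x j.
Proof.
move=> hj; rewrite col_factor_right // col1_right; last by lia.
have p : xbprod j != 0 by apply: xbprod_neq0; lia.
by field; rewrite level_neq0 p.
Qed.

(** The factor [(k != 0)] expresses that column [1] is exactly [w]: the diagonal
    summand [t] only appears from column [2] on. *)
Lemma left_colE k i : (k <= n - 2)%N -> (0 < i)%N ->
  left_col x z k i = w i * v k.+1 * (1 + t * (i < k.+1)%N%:R)
                     + t * (k != 0%N)%:R * (i == k.+1)%:R.
Proof.
move=> hk i0; elim: k hk => [|k IH] hk.
  rewrite col_factor_left ?xprod1; last by lia.
  have -> : (i < 1)%N = false by lia.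
  by rewrite /= invr1 !mulr0 mul0r !addr0 !mulr1.
rewrite [LHS]/= IH; last by lia.
have vS : v k.+2 = v k.+1 / xvar x k.+1.
  by rewrite !col_factor_left ?(@xprodS k.+1) ?invfM //; lia.
have x0 : xvar x k.+1 != 0 by apply: xvar_neq0; lia.
have xb0 : xbar x k.+1 != 0 by apply: xbar_neq0; lia.
have d : w k.+1 * v k.+1 = (k != 0%N)%:R + xvar x k.+1 / xbar x k.+1.
  by apply: diag_left; lia.
rewrite vS /kron.
have [->|ik] := eqVneq i k.+1.
  have -> : (k.+1 == k.+2) = false by lia.
  by rewrite ltnn ltnSn !mulrA d /=; field; rewrite x0 xb0.
have -> : (i < k.+2)%N = (i < k.+1)%N by lia.
by rewrite /=; field; rewrite x0 xb0.
Qed.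

Lemma col_nE i : (0 < i)%N -> col_n x z i = w i * v n * order_weight n t i n.
Proof.
move=> i0; rewrite /col_n left_colE //.
have -> : (n - 2).+1 = n.-1 by lia.
have -> : (n - 2 != 0)%N by lia.
have vS : v n = v n.-1 / xvar x n.-1.
  rewrite !col_factor_left //; last by lia.
  by rewrite -invfM -xprodS ?prednK //; lia.
have x0 : xvar x n.-1 != 0 by apply: xvar_neq0; lia.
have xb0 : xbar x n.-1 != 0 by apply: xbar_neq0; lia.
have d : w n.-1 * v n.-1 = 1 + xvar x n.-1 / xbar x n.-1.
  by rewrite diag_left; [have -> : (n.-1 != 1)%N by lia | lia].
have d1 : w n.+1 * v n = 1.
  by rewrite col1_n1 col_factor_left // mulfV // xprod_neq0 //; lia.
rewrite /kron /order_weight eqxx andbT.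
have -> : (n == n.*2) = false by lia.
rewrite andbF.
have [->|i1] := eqVneq i n.-1.
  have -> : (n.-1 == n.+1) = false by lia.
  have -> : (n.-1 < n)%N by lia.
  by rewrite ltnn vS !mulrA d /=; field; rewrite x0 xb0.
have -> : (i < n)%N = (i < n.-1)%N by lia.
have [->|i2] := eqVneq i n.+1.
  have -> : (n.+1 < n.-1)%N = false by lia.
  transitivity (w n.+1 * v n + t).
    by rewrite vS /=; field; rewrite x0 xb0.
  by rewrite d1 /=; ring.
have -> : (i < n.-1)%N = (i < n)%N by lia.
by rewrite vS /=; field; rewrite x0 xb0.
Qed.

Lemma col_n1E i : (0 < i)%N -> col_n1 x z i = w i * v n.+1 * order_weight n t i n.+1.
Proof.
move=> i0; rewrite /col_n1 left_colE //.
have -> : (n - 2).+1 = n.-1 by lia.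
have -> : (n - 2 != 0)%N by lia.
have x0 : xvar x n.-1 != 0 by apply: xvar_neq0; lia.
have xn0 : xvar x n != 0 by apply: xvar_neq0; lia.
have xb0 : xbar x n.-1 != 0 by apply: xbar_neq0; lia.
have p0 : xprod n != 0 by apply: xprod_neq0; lia.
have vS : v n.+1 = v n.-1 / (xvar x n.-1 * xvar x n).
  rewrite col_factor_n1 col_factor_left; last by lia.
  by rewrite -invfM mulrA -(@xprodS n.-1) ?prednK //; lia.
have d : w n.-1 * v n.-1 = 1 + xvar x n.-1 / xbar x n.-1.
  by rewrite diag_left; [have -> : (n.-1 != 1)%N by lia | lia].
have d1 : w n * v n.+1 = 1.
  by rewrite col1_n col_factor_n1 mulfV // mulf_neq0.
rewrite /kron /order_weight.
have -> : (n.+1 == n.*2) = false by lia.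
have -> : (n.+1 == n) = false by lia.
rewrite !andbF.
have [->|i1] := eqVneq i n.-1.
  have -> : (n.-1 == n) = false by lia.
  have -> : (n.-1 < n.+1)%N by lia.
  by rewrite ltnn vS !mulrA d /=; field; rewrite x0 xb0 xn0.
have [->|i2] := eqVneq i n.
  have -> : (n < n.-1)%N = false by lia.
  transitivity (w n * v n.+1 + t).
    by rewrite vS /=; field; rewrite x0 xb0 xn0.
  by rewrite d1 ltnSn /=; ring.
have -> : (i < n.-1)%N = (i < n.+1)%N by lia.
by rewrite vS /=; field; rewrite x0 xb0 xn0.
Qed.

(** The recursion produces [z l] times [w_i] above the diagonal; below it, the
    Kronecker terms that have accumulated in row [i] subtract [t w_i v_j].  On
    the diagonal of column [2n + 1 - J], where [w_i v_i = Xbar_J], they subtract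
    [t xbar_J / x_J = t (Xbar_J - 1)] from [z l Xbar_J], which leaves
    [Xbar_J + t]. *)
Lemma right_colE k i : (k <= n - 3)%N -> (0 < i <= n.*2)%N ->
  right_col x z k i = w i * v (n.*2.-1 - k) * (1 + t * (i < n.*2.-1 - k)%N%:R)
                     + t * (i == n.*2.-1 - k)%N%:R.
Proof.
move=> hk hi; elim: k hk => [|k IH] hk.
  have l0 := level_neq0.
  have d : w n.*2.-1 * v n.*2.-1 = Xbar x 2.
    have -> : n.*2.-1 = (n.*2.+1 - 2)%N by lia.
    by rewrite diag_right //; lia.
  have vE : v n.*2.-1 = xbar x 1 * Xbar x 2 / level x.
    have -> : n.*2.-1 = (n.*2.+1 - 2)%N by lia.
    by rewrite col_factor_right ?(@xbprodS 1) ?xbprod1 ?mul1r //; lia.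
  have x2 : xvar x 2 != 0 by apply: xvar_neq0; lia.
  rewrite subn0 /= /col_2n1 /kron.
  have [->|i1] := eqVneq i n.*2.-1.
    have -> : (n.*2.-1 == n.*2) = false by lia.
    transitivity (level x * z * (w n.*2.-1 * v n.*2.-1)
                  - t * (Xbar x 2 - 1)).
      by rewrite vE /Xbar /=; field; rewrite x2 l0.
    by rewrite ltnn d /=; ring.
  have [->|i2] := eqVneq i n.*2.
    have -> : (n.*2 < n.*2.-1)%N = false by lia.
    rewrite col1_last.
    by rewrite vE /=; field; rewrite x2 l0.
  have -> : (i < n.*2.-1)%N by lia.
  by rewrite vE /=; field; rewrite x2 l0.
rewrite [LHS]/= IH; last by lia.
have -> : (n.*2.-1 - k = n.*2.+1 - k.+2)%N by lia.
have -> : (n.*2.-1 - k.+1 = n.*2.+1 - k.+3)%N by lia.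
have -> : (n.*2 - k.+2 = n.*2.+1 - k.+3)%N by lia.
have hX : Xbar x k.+2 != 0 by apply: Xbar_neq0; lia.
have d : w (n.*2.+1 - k.+3)%N * v (n.*2.+1 - k.+3)%N = Xbar x k.+3.
  by apply: diag_right; lia.
have vS : v (n.*2.+1 - k.+3)%N
    = xbar x k.+2 * (Xbar x k.+3 / Xbar x k.+2) * v (n.*2.+1 - k.+2)%N.
  rewrite !col_factor_right ?(@xbprodS k.+2) //; try by lia.
  by field; rewrite hX level_neq0.
rewrite /kron.
have [->|i1] := eqVneq i (n.*2.+1 - k.+3)%N.
  have -> : (n.*2.+1 - k.+3 == n.*2.+1 - k.+2)%N = false by lia.
  have -> : (n.*2.+1 - k.+3 < n.*2.+1 - k.+2)%N by lia.
  transitivity (w (n.*2.+1 - k.+3)%N * v (n.*2.+1 - k.+3)%N * (1 + t)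
                - t * (Xbar x k.+3 - 1)).
    by rewrite vS /Xbar /=; ring.
  by rewrite ltnn d /=; ring.
have -> : (i < n.*2.+1 - k.+3)%N = (i < n.*2.+1 - k.+2)%N && (i != n.*2.+1 - k.+2)%N.
  by lia.
rewrite vS.
have [->|i2] := eqVneq i (n.*2.+1 - k.+2)%N; first by rewrite ltnn /=; ring.
by rewrite andbT /=; ring.
Qed.

Lemma col_2nE i : (0 < i <= n.*2)%N ->
  col_2n x z i = w i * v n.*2 * order_weight n t i n.*2.
Proof.
move=> hi; rewrite /col_2n col_factor_last /order_weight /kron eqxx andbT.
have l0 := level_neq0.
have x0 : xvar x 1 != 0 by apply: xvar_neq0; lia.
have xb0 : xbar x 1 != 0 by apply: xbar_neq0; lia.
have -> : (n.*2 == n) = false by lia.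
rewrite andbF.
have [->|i1] := eqVneq i 1%N.
  have -> : (1 == n.*2)%N = false by lia.
  have -> : (1 < n.*2)%N by lia.
  by rewrite col1_1 /=; field; rewrite x0 xb0 l0.
have [->|i2] := eqVneq i n.*2.
  rewrite col1_last.
  by rewrite ltnn /=; field; rewrite x0 l0.
have -> : (i < n.*2)%N by lia.
by rewrite /=; field; rewrite x0 l0.
Qed.

Lemma entryM_factor i j : (0 < i <= n.*2)%N -> (0 < j <= n.*2)%N ->
  entryM x z i j = w i * v j * order_weight n t i j + t * (regular n j)%:R * (i == j)%:R.
Proof.
move=> hi hj; rewrite /entryM /regular.
have i0 : (0 < i)%N by lia.
have [jn|jn] := ltnP j n.
  rewrite left_colE //; last by lia.
  rewrite prednK; last by lia.
  have -> : (j.-1 != 0)%N = (j != 1)%N by lia.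
  have -> : (j != n) by lia. have -> : (j != n.+1) by lia.
  have j2 : (j == n.*2) = false by lia.
  have j3 : (j == n) = false by lia.
  by rewrite /order_weight j2 j3 !andbF andbT /=; ring.
have [->|j1] := eqVneq j n; first by rewrite col_nE // andbF /=; ring.
have [->|j2] := eqVneq j n.+1; first by rewrite col_n1E // !andbF /=; ring.
have [->|j3] := eqVneq j n.*2; first by rewrite col_2nE // !andbF /=; ring.
rewrite right_colE //; last by lia.
have -> : (n.*2.-1 - (n.*2.-1 - j) = j)%N by lia.
have -> : (j != 1)%N by lia.
by rewrite /order_weight (negPf j1) (negPf j3) !andbF /=; ring.
Qed.

(** * The antisymmetric sequence behind the column factors *)

Definition alt_ratio (m : nat) : K :=
  if (0 < m < n)%N then (-1) ^+ m.-1 * (xbprod m.+1 / xprod m.+1) else 0.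

(** Antisymmetrising builds the rule [H_(2n - m) = - H_m] into the definition;
    it forces the partial sums of [l s_j v_j v_(j')] to return to zero at [n]
    and at [2n]. *)
Definition flux (m : nat) : K := alt_ratio m - alt_ratio (n.*2 - m).

Lemma flux_anti m : (m <= n.*2)%N -> flux (n.*2 - m) = - flux m.
Proof. by move=> hm; rewrite /flux subKn // opprB. Qed.

Lemma flux0 : flux 0 = 0.
Proof.
rewrite /flux /alt_ratio subn0.
have -> : (0 < n.*2 < n)%N = false by lia.
by rewrite subr0.
Qed.

Lemma flux_n : flux n = 0.
Proof. by rewrite /flux -addnn addnK subrr. Qed.

Lemma flux_left m : (0 < m < n)%N ->
  flux m = (-1) ^+ m.-1 * (xbprod m.+1 / xprod m.+1).
Proof.
move=> hm; rewrite /flux /alt_ratio hm.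
have -> : (0 < n.*2 - m < n)%N = false by lia.
by rewrite subr0.
Qed.

(** With [r_m = (x_1 ... x_m) / (xbar_1 ... xbar_m)] the products [v_j v_(j')] are
    [(1 / r_(j-1) + 1 / r_j) / l] for [1 < j < n], [1 / (l r_1)] for [j = 1] and
    [1 / (l r_(n-1))] for [j = n], so their alternating sums telescope.  Both
    sides are invariant under [j -> j'], which reduces to [j <= n]. *)
Lemma flux_increment j : (0 < j <= n.*2)%N ->
  level x * s j * (v j * v (n.*2.+1 - j)) = flux j - flux j.-1.
Proof.
have l0 := level_neq0.
move: j; apply: mirror_ind => j hj; last first.
  move=> IH; rewrite sign_sym ?subKn; try by lia.
  rewrite [v _ * v j]mulrC IH.
  have -> : (n.*2.+1 - j = n.*2 - j.-1)%N by lia.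
  have -> : ((n.*2 - j.-1).-1 = n.*2 - j)%N by lia.
  by rewrite !flux_anti ?opprK 1?addrC //; lia.
rewrite sign_left; last by lia.
rewrite (col_factor_left (j := j)); last by lia.
have [jn|jn] := ltnP j n; last first.
  have -> : j = n by lia.
  have -> : (n.*2.+1 - n = n.+1)%N by lia.
  rewrite col_factor_n1 flux_n (@flux_left n.-1); last by lia.
  rewrite prednK; last by lia.
  have -> : n.-1 = (n - 2).+1 by lia.
  have p : xprod n != 0 by apply: xprod_neq0; lia.
  have xn : xvar x n != 0 by apply: xvar_neq0; lia.
  by rewrite exprS levelE /=; field; rewrite p xn.
have xj : xvar x j != 0 by apply: xvar_neq0; lia.
have p : xprod j != 0 by apply: xprod_neq0; lia.
rewrite (@flux_left j); last by lia.
have j0 : (0 < j)%N by lia.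
rewrite (xprodS j0) (xbprodS j0).
have [j1|j1] := eqVneq j 1%N.
  rewrite j1 in xj p *.
  rewrite subSS subn0 col_factor_last flux0 xprod1 xbprod1 /=.
  by field; rewrite xj l0 oner_neq0.
rewrite col_factor_right; last by lia.
rewrite (@flux_left j.-1); last by lia.
rewrite prednK; last by lia.
have -> : j.-1 = j.-2.+1 by lia.
by rewrite exprS /Xbar /=; field; rewrite xj p l0.
Qed.

Lemma flux_regular j : (0 < j <= n.*2)%N -> regular n j ->
  level x * s j * v (n.*2.+1 - j) = flux j * w j.
Proof.
have l0 := level_neq0.
move=> hj /and4P[j1 j2 j3 j4]; have [jn|jn] := ltnP j n.
  rewrite sign_left; last by lia.
  rewrite col_factor_right ?flux_left ?col1_left //; try by lia.
  have xj : xvar x j != 0 by apply: xvar_neq0; lia.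
  have xbj : xbar x j != 0 by apply: xbar_neq0; lia.
  have p : xprod j != 0 by apply: xprod_neq0; lia.
  rewrite xprodS ?xbprodS /Xbar; try by lia.
  by field; rewrite xj xbj l0 p.
have [i [hi ->]] : exists i, (1 < i < n)%N /\ j = (n.*2.+1 - i)%N.
  by exists (n.*2.+1 - j)%N; lia.
rewrite sign_sym ?subKn ?sign_left ?col_factor_left ?col1_right; try by lia.
have -> : (n.*2.+1 - i = n.*2 - i.-1)%N by lia.
rewrite flux_anti ?flux_left ?prednK; try by lia.
have p : xprod i != 0 by apply: xprod_neq0; lia.
have q : xbprod i != 0 by apply: xbprod_neq0; lia.
have -> : i.-1 = i.-2.+1 by lia.
by rewrite exprS /=; field; rewrite p q.
Qed.

(** The two pairs [{1, 2n}] and [{n, n+1}] have reciprocal diagonal values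
    [x_1 / xbar_1] and [xbar_1 / x_1], respectively [x_n] and [1 / x_n]. *)
Lemma diag_irregular j : (0 < j <= n.*2)%N -> ~~ regular n j ->
  w j * v j * (w (n.*2.+1 - j)%N * v (n.*2.+1 - j)%N) = 1.
Proof.
have l0 := level_neq0.
have x0 : xvar x 1 != 0 by apply: xvar_neq0; lia.
have xb0 : xbar x 1 != 0 by apply: xbar_neq0; lia.
have xn0 : xvar x n != 0 by apply: xvar_neq0; lia.
have p0 : xprod n != 0 by apply: xprod_neq0; lia.
have ends : w 1 * v 1 * (w n.*2 * v n.*2) = 1.
  rewrite col1_1 col_factor_left ?xprod1 ?col1_last ?col_factor_last; last by lia.
  by field; rewrite x0 xb0 l0 oner_neq0.
have middle : w n * v n * (w n.+1 * v n.+1) = 1.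
  rewrite col1_n col1_n1 col_factor_left // col_factor_n1.
  by field; rewrite xn0 p0.
move=> hj; rewrite /regular.
have [->|j1] := eqVneq j 1%N; first by rewrite subSS subn0 ends.
have [->|j2] := eqVneq j n.
  by have -> : (n.*2.+1 - n = n.+1)%N by lia.
have [->|j3] := eqVneq j n.+1.
  have -> : (n.*2.+1 - n.+1 = n)%N by lia.
  by rewrite mulrC.
have [->|j4] //= := eqVneq j n.*2.
by rewrite subSn // subnn mulrC.
Qed.

(** * Orthogonality of the rows *)

(** The level [l] is nonzero and may be cancelled; after scaling by it the products [v_j v_(j')] become increments of [flux].  The term in
    [t ^ 2] and the bracket of [order_weight_pairing] contribute to complementary
    indices: the first when [i] is regular, the second when it is not. *)
Lemma row_pairing i k : (0 < i <= n.*2)%N -> (0 < k <= n.*2)%N ->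
  \sum_(0 <= j < n.*2) s j.+1 * entryM x z i j.+1 * entryM x z k (n.*2 - j)
  = t ^+ 2 * s i * (i + k == n.*2.+1)%N%:R.
Proof.
move=> hi hk; have l0 := level_neq0; apply: (mulfI l0).
have reg a : (0 < a <= n.*2)%N ->
  level x * s a * v (n.*2.+1 - a) * (regular n a)%:R = flux a * w a * (regular n a)%:R.
  move=> ha; case: (boolP (regular n a)) => [ra|_]; last by rewrite !mulr0.
  by rewrite flux_regular.
transitivity (w i * w k * (\sum_(0 <= j < n.*2)
     (flux j.+1 - flux j) * order_weight n t i j.+1 * order_weight n t k (n.*2 - j)%N)
  + \sum_(0 <= j < n.*2) level x * s j.+1 * t * w k * v (n.*2 - j)
       * order_weight n t k (n.*2 - j) * (regular n j.+1)%:R * (j == i.-1)%:R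
  + \sum_(0 <= j < n.*2) level x * s j.+1 * t * w i * v j.+1
       * order_weight n t i j.+1 * (regular n (n.*2 - j))%:R * (j == n.*2 - k)%N%:R
  + \sum_(0 <= j < n.*2) level x * s j.+1 * t ^+ 2 * (k == n.*2 - j)%N%:R
       * (regular n (n.*2 - j))%:R * (regular n j.+1)%:R * (j == i.-1)%:R).
  rewrite !mulr_sumr -!big_split /=; apply: eq_big_nat => j hj.
  rewrite !entryM_factor; try by lia.
  have := @flux_increment j.+1; rewrite subSS /= => <-; last by lia.
  have -> : (j == i.-1) = (i == j.+1) by lia.
  have -> : (j == n.*2 - k)%N = (k == n.*2 - j)%N by lia.
  by ring.
rewrite !sum_kronecker; try by lia.
rewrite prednK; last by lia.
have -> : (n.*2 - i.-1 = n.*2.+1 - i)%N by lia.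
have -> : ((n.*2 - k).+1 = n.*2.+1 - k)%N by lia.
rewrite subKn ?sign_sym; try by lia.
have -> : (k == n.*2.+1 - i)%N = (i + k == n.*2.+1)%N by lia.
have reg_sym : regular n (n.*2.+1 - i) = regular n i by rewrite /regular; lia.
transitivity (w i * w k *
    (\sum_(0 <= j < n.*2)
       (flux j.+1 - flux j) * order_weight n t i j.+1 * order_weight n t k (n.*2 - j)
     + t * (regular n i)%:R * flux i * order_weight n t k (n.*2.+1 - i)%N
     + t * (regular n k)%:R * flux k * order_weight n t i (n.*2.+1 - k)%N)
  + level x * s i * t ^+ 2 * (i + k == n.*2.+1)%N%:R * (regular n i)%:R).
  have ri := reg i hi; have rk := reg k hk.
  transitivity (w i * w k *
      (\sum_(0 <= j < n.*2)
         (flux j.+1 - flux j) * order_weight n t i j.+1 * order_weight n t k (n.*2 - j))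
    + t * w k * order_weight n t k (n.*2.+1 - i)%N
        * (level x * s i * v (n.*2.+1 - i) * (regular n i)%:R)
    + t * w i * order_weight n t i (n.*2.+1 - k)%N
        * (level x * s k * v (n.*2.+1 - k) * (regular n k)%:R)
    + level x * s i * t ^+ 2 * (i + k == n.*2.+1)%N%:R
        * ((regular n i)%:R * (regular n i)%:R)).
    by rewrite reg_sym; ring.
  rewrite ri rk -natrM mulnb andbb; ring.
rewrite order_weight_pairing //; [|exact: flux_anti|exact: flux0|exact: flux_n].
have [ik|_] := eqVneq (i + k)%N n.*2.+1; last by rewrite andbF /=; ring.
have [ri|ri] := boolP (regular n i); first by rewrite /=; ring.
have ek : k = (n.*2.+1 - i)%N by lia.
rewrite -flux_increment // -ek /= mulr0 addr0.
transitivity (t ^+ 2 * level x * s i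
    * (w i * v i * (w (n.*2.+1 - i)%N * v (n.*2.+1 - i)%N))).
  by rewrite -ek /=; ring.
by rewrite diag_irregular //=; ring.
Qed.

End Factors.

Theorem proposition3p6 (K : fieldType) (n : nat) (hn : (4 <= n)%N)
    (x : (n.*2.-1).-tuple K) (z : K) (hx : M_defined x) :
  mxM x z *m mxS K n *m (mxM x z)^T *m mxS K n
    = ((1 - z * level x) ^+ 2)%:M.
Proof.
apply/matrixP => i k; rewrite mulmxSE mxE.
have hi := ltn_ord i; have hk := ltn_ord k.
have hk' : (0 < n.*2 - k <= n.*2)%N by lia.
have hi' : (0 < i.+1 <= n.*2)%N by lia.
have -> : \sum_j (mxM x z *m mxS K n) i j * (mxM x z)^T j (rev_ord k)
    = \sum_(0 <= j < n.*2) antidiag_sign K n j.+1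
        * entryM x z (n.*2 - k) j.+1 * entryM x z i.+1 (n.*2 - j).
  rewrite -addnn big_mkord; apply: eq_bigr => j _; rewrite mulmxSE !mxE.
  have hj := ltn_ord j.
  have -> : (rev_ord j).+1 = (n + n - j)%N by rewrite /=; lia.
  have -> : (rev_ord k).+1 = (n + n - k)%N by rewrite /=; lia.
  by rewrite -mulrA [X in _ * X]mulrC mulrA.
rewrite row_pairing // mxE.
have -> : (n.*2 - k)%N = (n.*2.+1 - k.+1)%N by lia.
rewrite sign_sym; last by lia.
have -> : (n.*2.+1 - k.+1 + i.+1 == n.*2.+1)%N = (i == k).
  by rewrite -val_eqE /=; lia.
transitivity ((antidiag_sign K n k.+1 * antidiag_sign K n k.+1)
   * (level x * z - 1) ^+ 2 * (i == k)%:R); first by ring.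
by rewrite antidiag_sign_sqr mul1r -[RHS]mulr_natr; congr (_ * _); ring.
Qed.
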